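(* Let $D$ be an (associative) division ring with center $F$. Let $$P(x)=(x-d_n)(x-d_{n-1})\cdots(x-d_1)\in D[x],$$ where $d_1,\dots,d_n\in D$. Assume that $d_1,\dots,d_{n-1}$ are algebraic over $F$, and for $i=1,\dots,n-1$ let $f_i(x)\in F[x]$ be the minimal polynomial of $d_i$ over $F$ and let $S_i(x)\in D[x]$ be the polynomial such that $f_i(x)=S_i(x)(x-d_i)$. Set $$P_1(x):=1,\qquad P_k(x):=S_1(x)S_2(x)\cdots S_{k-1}(x)\quad\text{for } 2\le k\le n.$$ If the conjugacy classes $[d_1],\dots,[d_n]$ are pairwise distinct, then $P(x)$ has exactly $n$ roots $\zeta_1,\dots,\zeta_n$ in $D$, and they are given by $$\zeta_k=P_k(d_k)\,d_k\,\big(P_k(d_k)\big)^{-1},\qquad k=1,\dots,n.$$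
   Context: For a division ring $D$, $D[x]$ denotes the ring of polynomials in one variable $x$ over $D$, where $x$ commutes with every element of $D$, so that $(\sum_i a_i x^i)(\sum_j b_j x^j)=\sum_k\big(\sum_{i+j=k}a_ib_j\big)x^k$. Polynomials are written with coefficients on the left, and for $P(x)=a_nx^n+\dots+a_1x+a_0\in D[x]$ and $a\in D$ one defines $P(a):=a_na^n+\dots+a_1a+a_0$. In particular, the value at $a$ of a product of polynomials is computed by first expanding the product in $D[x]$ and then substituting; it is in general not the product of the values. An element $a\in D$ is a (right) root (zero) of $P(x)$ if $P(a)=0$. The conjugacy class of $a\in D$ is $[a]:=\{dad^{-1}\mid d\in D\setminus\{0\}\}$. *)

(* Defs.v *)
From HB Require Import structures.
From mathcomp Require Import all_boot all_order all_algebra.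
From mathcomp Require Import boolp classical_sets.

Set Implicit Arguments.
Unset Strict Implicit.
Unset Printing Implicit Defensive.

Import GRing.Theory.
Local Open Scope classical_set_scope.
Local Open Scope ring_scope.

Definition division_ring (D : unitRingType) : Prop :=
  forall x : D, x != 0 -> x \is a GRing.unit.

Definition center (D : unitRingType) : set D :=
  [set z | forall y : D, GRing.comm z y].

Arguments center D : clear implicits.

(* F[x], for F the center of D, is taken inside {poly D}: it is the set of
   the polynomials whose coefficients are central. *)
Definition center_poly (D : unitRingType) : set {poly D} :=
  [set p : {poly D} | forall i, center D p`_i].

Definition algebraic_over_center (D : unitRingType) (a : D) : Prop :=
  exists p : {poly D}, [/\ center_poly p, p != 0 & root p a].

Definition is_minpoly_over_center (D : unitRingType) (a : D) (f : {poly D})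
    : Prop :=
  [/\ center_poly f, f \is monic, root f a
    & forall g : {poly D},
        center_poly g -> g != 0 -> root g a -> (size f <= size g)%N].

Definition conj_class (D : unitRingType) (a : D) : set D :=
  [set u * a * u^-1 | u in [set u : D | u != 0]].

(* Indices are shifted by one: the i-th member (i < n) of a family over 'I_n
   stands for the (i+1)-st element of the family d_1, ..., d_n. *)

(* (x - d_n) ... (x - d_1); as D need not be commutative the order of the
   factors matters, and [rev_ord] puts the last index first. *)
Definition linear_prod (D : unitRingType) (n : nat) (d : 'I_n -> D)
    : {poly D} :=
  \prod_(i < n) ('X - (d (rev_ord i))%:P).

(* For the (0-based) k this is S_1 ... S_k, that is P_(k+1); the members of S
   are indexed by 1, ..., n-1 only. *)
Definition partial_prod (D : unitRingType) (n : nat)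
    (S : 'I_n.-1 -> {poly D}) (k : 'I_n) : {poly D} :=
  \prod_(i < n.-1 | (i < k)%N) S i.

Definition zeta (D : unitRingType) (n : nat) (d : 'I_n -> D)
    (S : 'I_n.-1 -> {poly D}) (k : 'I_n) : D :=
  (partial_prod S k).[d k] * d k * ((partial_prod S k).[d k])^-1.

(* Main.v *)
(* Write Q_k = (x - d_k) ... (x - d_1). The product formula
   (p q)(a) = p(q(a) a q(a)^-1) q(a) for q(a) != 0 shows that every root of P
   is conjugate to some d_k. Each class contains at most one root: if z and z'
   are roots of (x - c) q conjugate to c, and q has no root in [c], then
   u |-> q(u c u^-1) u = (q u)(c) is injective and right linear over the
   centralizer of c, and it maps the elements conjugating c to z or z' into
   that centralizer; hence these elements differ by a right factor commuting
   with c. For existence, Q_(k-1) P_k = f_1 ... f_(k-1) is central and, by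
   Dickson's theorem (the roots of a minimal polynomial over the center are
   conjugate), does not vanish at d_k, so P_k(d_k) != 0; as
   Q_k P_k = (x - d_k) f_1 ... f_(k-1) vanishes at d_k, the product formula
   makes zeta_k a root of Q_k. *)

Require Import Defs.
From HB Require Import structures.
From mathcomp Require Import all_boot all_order all_algebra.
From mathcomp Require Import boolp classical_sets.

Set Implicit Arguments.
Unset Strict Implicit.
Unset Printing Implicit Defensive.

Import GRing.Theory.
Local Open Scope classical_set_scope.
Local Open Scope ring_scope.

(** * Evaluation of products and central polynomials *)

(** This is the product formula without inverses; it also covers [q.[a] = 0], where every [z]
    qualifies. *)
Lemma horner_mul_twist (R : nzRingType) (p q : {poly R}) (a z : R) :
  z * q.[a] = q.[a] * a -> (p * q).[a] = p.[z] * q.[a].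
Proof.
move=> za; elim/poly_ind: p => [|p c IHp]; first by rewrite mul0r !horner0 mul0r.
rewrite mulrDl -mulrA -commr_polyX mulrA hornerD hornerMX IHp hornerCM.
by rewrite hornerD hornerMX hornerC mulrDl -!mulrA za.
Qed.

Lemma root_mull (R : nzRingType) (p q : {poly R}) (a : R) :
  root q a -> root (p * q) a.
Proof.
move=> /eqP qa; apply/eqP.
by rewrite (@horner_mul_twist _ _ _ _ 0) qa ?mulr0 ?mul0r.
Qed.

(** This is the condition of [hornerM_comm]: values multiply when the right factor is central. *)
Lemma horner_comm_polyC (R : nzRingType) (f : {poly R}) (a : R) :
  GRing.comm f a%:P -> comm_poly f a.
Proof.
move=> fa; rewrite /comm_poly -hornerCM -fa (@horner_mul_twist _ _ _ _ a) //;
by rewrite hornerC.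
Qed.

Lemma center_poly_comm (D : unitRingType) (f p : {poly D}) :
  center_poly f -> GRing.comm f p.
Proof.
move=> fZ; apply/polyP => i; rewrite coefM coefMr.
by apply: eq_bigr => j _; exact: fZ.
Qed.

Lemma comm_center_poly (D : unitRingType) (f : {poly D}) :
  (forall c : D, GRing.comm f c%:P) -> center_poly f.
Proof. by move=> fZ i c; rewrite /GRing.comm -coefMC -coefCM fZ. Qed.

Section DivisionRing.
Variables (D : unitRingType) (divD : division_ring D).
Implicit Types (a b c u x y z : D) (p q f h S : {poly D}).

(** * Conjugacy classes in a division ring *)

Lemma divring_mulf_eq0 x y : (x * y == 0) = (x == 0) || (y == 0).
Proof.
have [->|/divD ux] := eqVneq x 0; first by rewrite mul0r eqxx.
by rewrite mulrI_eq0 //; exact: mulrI.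
Qed.

Lemma conj_classP a z u : u != 0 -> z * u = u * a -> conj_class a z.
Proof. by move=> u0 zu; exists u => //; rewrite -zu mulrK ?divD. Qed.

Lemma conj_class_twist a z :
  conj_class a z -> exists2 u, u != 0 & z * u = u * a.
Proof. by case=> u /= u0 <-; exists u => //; rewrite mulrVK ?divD. Qed.

Lemma conj_class_sub a b : conj_class a b -> conj_class b `<=` conj_class a.
Proof.
move=> /conj_class_twist[u u0 bu] z /conj_class_twist[v v0 zv].
by apply: (@conj_classP _ _ (v * u));
  rewrite ?divring_mulf_eq0 ?negb_or ?v0 // mulrA zv -!mulrA bu.
Qed.

Lemma conj_class_sym a b : conj_class a b -> conj_class b a.
Proof.
case/conj_class_twist=> u u0 bu; have uu := divD u0.
apply: (@conj_classP _ _ u^-1); first by rewrite invr_eq0.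
by apply: (mulrI uu); rewrite mulrA -bu -!mulrA mulrV // mulr1 mulrA mulrV ?mul1r.
Qed.

Lemma conj_class_eq a b : conj_class a b -> conj_class a = conj_class b.
Proof.
by move=> ab; apply/seteqP; split; apply: conj_class_sub => //;
  exact: conj_class_sym.
Qed.

(** * Roots of a product within a conjugacy class *)

Lemma rootM_conj p q a : root (p * q) a ->
  root q a \/ exists2 z, conj_class a z & root p z.
Proof.
move=> pqa; have [qa|qa] := boolP (root q a); [by left|right].
have za : q.[a] * a / q.[a] * q.[a] = q.[a] * a by rewrite mulrVK ?divD.
exists (q.[a] * a / q.[a]); first exact: conj_classP za.
move: pqa; rewrite /root (horner_mul_twist _ za) divring_mulf_eq0.
by rewrite orbC; case/orP => // /eqP qa0; rewrite /root qa0 eqxx in qa.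
Qed.


(** The product is p x - c p, so its value at a is p(a) a - c p(a). *)
Lemma rootXsubCM_twist p a c :
  root (('X - c%:P) * p) a -> c * p.[a] = p.[a] * a.
Proof.
rewrite /root mulrBl -commr_polyX hornerD hornerN hornerMX hornerCM subr_eq0.
by move/eqP.
Qed.

Lemma rootXsubCM_conj p a c :
  root (('X - c%:P) * p) a -> root p a \/ conj_class c a.
Proof.
case/rootM_conj => [|[z az]]; first by left.
by rewrite root_XsubC => /eqP zc; right; apply: conj_class_sym; rewrite -zc.
Qed.

Lemma root_conj_unique p c z z' :
    (forall y, conj_class c y -> ~~ root p y) ->
    conj_class c z -> conj_class c z' ->
    root (('X - c%:P) * p) z -> root (('X - c%:P) * p) z' ->
  z = z'.
Proof.
move=> pc cz cz' /rootXsubCM_twist pz /rootXsubCM_twist pz'.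
have [u u0 zu] := conj_class_twist cz; have [v v0 zv] := conj_class_twist cz'.
have pzu : p.[z] * u \is a GRing.unit.
  by rewrite divD // divring_mulf_eq0 negb_or u0 andbT pc.
(* Both p(z) u and p(z') v commute with c, hence so does the quotient k, and u k conjugates c to z
   as u does. *)
have [k puk] : exists k, p.[z] * u * k = p.[z'] * v.
  by exists ((p.[z] * u)^-1 * (p.[z'] * v)); rewrite mulVKr.
have ck : c * k = k * c.
  apply: (mulrI pzu); rewrite !mulrA -[_ * u * c]mulrA -zu mulrA -pz.
  rewrite puk -[p.[z'] * v * c]mulrA -zv mulrA -pz'.
  by rewrite -!mulrA [p.[z] * _]mulrA puk.
have zuk : z * (u * k) = u * k * c by rewrite mulrA zu -!mulrA ck.
have pzuk : p.[z] * (u * k) = p.[z'] * v.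
  by rewrite mulrA.
have [ukv|ukv] := eqVneq (u * k) v.
  by apply: (mulIr (divD v0)); rewrite zv -ukv.
(* A nonzero w would make w c w^-1 a root of p in the class of c, since (p w)(c) = p(z) u k - p(z')
   v = 0. *)
have w0 : u * k - v != 0 by rewrite subr_eq0.
set w := u * k - v in w0.
have yw : w * c / w * w = w * c by rewrite mulrVK ?divD.
have /negP[] := pc _ (conj_classP w0 yw).
have : (p * w%:P).[c] = 0.
  rewrite /w polyCB mulrBr hornerD hornerN.
  rewrite (@horner_mul_twist _ _ (u * k)%:P c z) ?hornerC //.
  by rewrite (@horner_mul_twist _ _ v%:P c z') ?hornerC // pzuk subrr.
rewrite (@horner_mul_twist _ _ w%:P c (w * c / w)) ?hornerC // => /eqP.
by rewrite divring_mulf_eq0 (negPf w0) orbF.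
Qed.

(** * Polynomials vanishing on a class, and Dickson's theorem *)

(** With c u = u b, centrality gives 0 = u f(b) = (u f)(b) = (f u)(b) = f(c) u. *)
Lemma root_center_conj f b c :
  center_poly f -> conj_class b c -> root f b -> root f c.
Proof.
move=> fZ /conj_class_twist[u u0 cu] /eqP fb; have := hornerCM u f b.
rewrite fb mulr0 -(center_poly_comm _ fZ).
rewrite (@horner_mul_twist _ _ _ _ c) hornerC // => /eqP.
by rewrite divring_mulf_eq0 (negPf u0) orbF.
Qed.

(* Minimality forces centrality: h u - u h vanishes on the class too, and has
   smaller size. *)
Lemma conj_class_annihilator b p :
    p != 0 -> (forall c, conj_class b c -> root p c) ->
  exists h, [/\ h \is monic, center_poly h, forall c, conj_class b c -> root h c
    & forall g, g != 0 -> (forall c, conj_class b c -> root g c) ->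
      (size h <= size g)%N].
Proof.
move=> p0 pb.
pose ann n := `[< exists g, [/\ g != 0, forall c, conj_class b c -> root g c
  & size g = n] >].
have /ex_minnP[n /asboolP[g [g0 gb gn]] nmin] : exists n, ann n.
  by exists (size p); apply/asboolP; exists p.
have gmin q : q != 0 -> (forall c, conj_class b c -> root q c) ->
    (size g <= size q)%N.
  by move=> q0 qb; rewrite gn; apply: nmin; apply/asboolP; exists q.
have ul : (lead_coef g)^-1 \is a GRing.unit.
  by rewrite unitrV divD // lead_coef_eq0.
pose h := (lead_coef g)^-1 *: g.
have hsize : size h = size g by rewrite lreg_size //; exact: mulrI.
have hmonic : h \is monic.
  apply/monicP; rewrite lead_coef_lreg ?mulVr //; last exact: mulrI.
  by rewrite -unitrV.
have hb c : conj_class b c -> root h c.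
  by move=> /gb /eqP gc; rewrite /root hornerZ gc mulr0.
exists h; split => //; last by move=> q; rewrite hsize; exact: gmin.
apply: comm_center_poly => u; have [->|u0] := eqVneq u 0.
  by rewrite /GRing.comm mulr0 mul0r.
apply/eqP; rewrite -subr_eq0; apply: contraT => r0.
suff rlt : (size (h * u%:P - u%:P * h)%R < size h)%N.
  have := gmin _ r0; rewrite -hsize leqNgt rlt; apply=> c bc.
  rewrite /root hornerD hornerN hornerCM.
  (* (h u)(c) = h(u c u^-1) u, and u c u^-1 is again in the class. *)
  have cu : u * c / u * u = u * c by rewrite mulrVK ?divD.
  rewrite (@horner_mul_twist _ _ _ _ (u * c / u)) hornerC //.
  have /eqP -> := hb _ (conj_class_sub bc (conj_classP u0 cu)).
  by have /eqP -> := hb _ bc; rewrite mul0r mulr0 subrr.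
(* As h is monic, both products have coefficient u at index [(size h).-1], and it cancels. *)
have hs : (size h).-1.+1 = size h by rewrite prednK // lt0n size_poly_eq0 monic_neq0.
rewrite -hs ltnS; apply/leq_sizeP => j.
rewrite coefB coefMC coefCM leq_eqVlt => /predU1P[<-|hj].
  by rewrite -lead_coefE (monicP hmonic) mul1r mulr1 subrr.
by rewrite nth_default ?mul0r ?mulr0 ?subrr // -hs.
Qed.

(** f (x - a) = (x - a) f = (x - a) S (x - a), and the monic x - a cancels on the right. *)
Lemma central_factor_comm (f S : {poly D}) a :
  center_poly f -> f = S * ('X - a%:P) -> f = ('X - a%:P) * S.
Proof.
move=> fZ fE; apply: (monic_rreg (monicXsubC a)).
by rewrite (center_poly_comm _ fZ) {1}fE mulrA.
Qed.

Lemma minpoly_root_conj a b f :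
  is_minpoly_over_center a f -> root f b -> conj_class a b.
Proof.
case=> fZ fmonic fa fmin fb; apply: contrapT => nab.
have f0 := monic_neq0 fmonic.
(* If b is not conjugate to a, then f = (x - a) S with S vanishing on [b], so
   the central generator h of the polynomials vanishing on [b] is a proper
   divisor of f in F[x]. *)
have [S fS] := factor_theorem _ _ fa.
have S0 : S != 0 by apply: contraNneq f0 => S0; rewrite fS S0 mul0r.
have sfS : size f = (size S).+1.
  by rewrite fS size_Mmonic ?monicXsubC // size_XsubC addnS addn1.
have Sb c : conj_class b c -> root S c.
  move=> bc; have := root_center_conj fZ bc fb.
  rewrite (central_factor_comm fZ fS) => /rootXsubCM_conj[//|ac].
  by case: nab; apply: conj_class_sub ac _ _; exact: conj_class_sym.
have [h [hmonic hZ hb hmin]] := conj_class_annihilator S0 Sb.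
have := Pdiv.RingMonic.rdivp_eq hmonic f.
set q := Pdiv.CommonRing.rdivp _ _; set r := Pdiv.CommonRing.rmodp _ _ => fE.
(* The remainder vanishes on [b] and is smaller than h, so it is zero by minimality of h. *)
have r0 : r = 0.
  apply/eqP; apply: contraT => r0; have := hmin _ r0.
  rewrite leqNgt Pdiv.CommonRing.ltn_rmodpN0 ?monic_neq0 //; apply=> c bc.
  have := root_center_conj fZ bc fb.
  by rewrite fE /root hornerD (eqP (root_mull q (hb _ bc))) add0r.
rewrite {}r0 addr0 in fE.
have q0 : q != 0 by apply: contraNneq f0 => q0; rewrite fE q0 mul0r.
have qZ : center_poly q.
  apply: comm_center_poly => c; apply: (monic_rreg hmonic).
  by rewrite -mulrA -(center_poly_comm _ hZ) mulrA -fE (center_poly_comm _ fZ) fE mulrA.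
have hsize : (1 < size h)%N.
  rewrite ltnNge; apply/negP => /size1_polyC hC.
  have b_b : conj_class b b by apply: (@conj_classP _ _ 1); rewrite ?oner_neq0 ?mulr1 ?mul1r.
  have := hb _ b_b; rewrite hC rootC => /eqP h00.
  by have := monic_neq0 hmonic; rewrite hC h00 eqxx.
(* As h is central, a is a root of q or of h. Both are smaller than f: h because size h <= size S, q
   because h is not constant. *)
have := fa; rewrite {1}fE /root hornerM_comm; last first.
  exact/horner_comm_polyC/center_poly_comm.
rewrite divring_mulf_eq0 => /orP[] /fmin; last first.
  move=> /(_ hZ (monic_neq0 hmonic)); rewrite sfS ltnNge.
  by rewrite hmin.
move=> /(_ qZ q0); rewrite fE size_Mmonic //.
case: (size h) hsize => [|[|m]] // _; rewrite !addnS /= -{2}[size q]addn0.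
by rewrite ltn_add2l.
Qed.

(** * Roots of products of linear factors *)

(** This is Q_n for d_(i+1) = [e i]. One family over [nat] serves all lengths, so induction can peel
    off the leftmost factor. *)
Definition rev_linear_prod (e : nat -> D) n : {poly D} :=
  \prod_(i < n) ('X - (e (n - i.+1)%N)%:P).

Lemma rev_linear_prodS e n :
  rev_linear_prod e n.+1 = ('X - (e n)%:P) * rev_linear_prod e n.
Proof. by rewrite /rev_linear_prod big_ord_recl subSS subn0. Qed.

Lemma root_rev_linear_prod_conj e n z : root (rev_linear_prod e n) z ->
  exists2 i, (i < n)%N & conj_class (e i) z.
Proof.
elim: n => [|n IHn].
  by rewrite /rev_linear_prod big_ord0 (negPf (root1 _)).
rewrite rev_linear_prodS => /rootXsubCM_conj[/IHn[i i_n ez]|]; last by exists n.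
by exists i => //; exact: ltnW.
Qed.

(** Induction on n: if z is conjugate to [e n], the shorter product has no root in that class and
    [root_conj_unique] applies; otherwise z and z' are both roots of the shorter product. *)
Lemma root_rev_linear_prod_unique e n z z' :
    (forall i j, (i < n)%N -> (j < n)%N ->
       conj_class (e i) = conj_class (e j) -> i = j) ->
    root (rev_linear_prod e n) z -> root (rev_linear_prod e n) z' ->
    conj_class z z' ->
  z = z'.
Proof.
elim: n => [|n IHn] einj; first by rewrite /rev_linear_prod big_ord0 (negPf (root1 _)).
rewrite rev_linear_prodS => rz rz' zz'.
have [ez|nez] := pselect (conj_class (e n) z).
  apply: root_conj_unique ez (conj_class_sub ez zz') rz rz' => y ey.
  apply/negP => /root_rev_linear_prod_conj[i i_n eiy].
  have := einj i n (ltnW i_n) (ltnSn n).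
  rewrite (conj_class_eq eiy) (conj_class_eq ey) => /(_ erefl) i_eq_n.
  by rewrite i_eq_n ltnn in i_n.
case/rootXsubCM_conj: rz => // rz; case/rootXsubCM_conj: rz' => [rz'|ez'].
  by apply: IHn => // i j i_n j_n; apply: einj; exact: ltnW.
by case: nez; apply: conj_class_sub ez' _ _; exact: conj_class_sym.
Qed.

(** * Cofactors of the linear factors *)

Lemma comm_prod_center_poly (f : nat -> {poly D}) n p :
  (forall i, (i < n)%N -> center_poly (f i)) ->
  GRing.comm (\prod_(i < n) f i) p.
Proof.
move=> fZ; apply/commr_sym/commr_prod => i _; apply/commr_sym.
by apply: center_poly_comm; exact: fZ.
Qed.

(** In (x - e_n) Q_n S_0 ... S_n the part Q_n S_0 ... S_(n-1) is central by induction; moved to the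
    left, it leaves (x - e_n) S_n = f_n. *)
Lemma rev_linear_prod_cofactor e (f S : nat -> {poly D}) n :
    (forall i, (i < n)%N -> center_poly (f i)) ->
    (forall i, (i < n)%N -> f i = S i * ('X - (e i)%:P)) ->
  rev_linear_prod e n * \prod_(i < n) S i = \prod_(i < n) f i.
Proof.
elim: n => [|n IHn] fZ fS; first by rewrite /rev_linear_prod !big_ord0 mulr1.
have fZ' i : (i < n)%N -> center_poly (f i) by move=> /ltnW; exact: fZ.
rewrite rev_linear_prodS !big_ord_recr /= -mulrA [X in _ * X]mulrA IHn //; last first.
  by move=> i /ltnW; exact: fS.
rewrite mulrA -(comm_prod_center_poly _ fZ') -mulrA.
by rewrite -(central_factor_comm (fZ n _) (fS n _)).
Qed.

Lemma prod_center_neq0 (f : nat -> {poly D}) n a :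
    (forall i, (i < n)%N -> center_poly (f i)) ->
    (forall i, (i < n)%N -> ~~ root (f i) a) ->
  ~~ root (\prod_(i < n) f i) a.
Proof.
elim: n => [|n IHn] fZ fa; first by rewrite big_ord0 root1.
rewrite big_ord_recr /= /root hornerM_comm; last first.
  by apply/horner_comm_polyC/center_poly_comm; exact: fZ.
rewrite divring_mulf_eq0 negb_or [X in _ && X]fa // andbT.
by apply: IHn => i /ltnW; [exact: fZ|exact: fa].
Qed.

Lemma cofactor_prod_neq0 e (f S : nat -> {poly D}) n :
    (forall i, (i < n)%N -> is_minpoly_over_center (e i) (f i)) ->
    (forall i, (i < n)%N -> f i = S i * ('X - (e i)%:P)) ->
    (forall i, (i < n)%N -> conj_class (e i) <> conj_class (e n)) ->
  (\prod_(i < n) S i).[e n] != 0.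
Proof.
move=> fmin fS ne.
have fZ i : (i < n)%N -> center_poly (f i) by move=> /fmin[].
have fe i : (i < n)%N -> ~~ root (f i) (e n).
  move=> i_n; apply/negP => /(minpoly_root_conj (fmin i i_n))/conj_class_eq.
  exact: ne.
have := prod_center_neq0 fZ fe; rewrite -(rev_linear_prod_cofactor fZ fS).
by apply: contraNneq => S0; apply: root_mull; apply/eqP.
Qed.

Lemma root_rev_linear_prod_cofactor e (f S : nat -> {poly D}) n z :
    (forall i, (i < n)%N -> center_poly (f i)) ->
    (forall i, (i < n)%N -> f i = S i * ('X - (e i)%:P)) ->
    (\prod_(i < n) S i).[e n] != 0 ->
    z * (\prod_(i < n) S i).[e n] = (\prod_(i < n) S i).[e n] * e n ->
  root (rev_linear_prod e n.+1) z.
Proof.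
move=> fZ fS S0 zS.
have /eqP : root (rev_linear_prod e n.+1 * \prod_(i < n) S i) (e n).
  (* The product is x - e_n times a central polynomial, so x - e_n can be made the right factor. *)
  rewrite rev_linear_prodS -mulrA (rev_linear_prod_cofactor fZ fS).
  by rewrite -(comm_prod_center_poly _ fZ) root_mull // root_XsubC.
rewrite (horner_mul_twist _ zS) => /eqP.
by rewrite divring_mulf_eq0 (negPf S0) orbF.
Qed.

(** Q_m is a right factor of Q_n, and roots of a right factor are roots of the product. *)
Lemma root_rev_linear_prod_leq e m n z : (m <= n)%N ->
  root (rev_linear_prod e m) z -> root (rev_linear_prod e n) z.
Proof.
move=> /subnK <-; elim: (n - m)%N => // k IHk rz.
by rewrite addSn rev_linear_prodS root_mull // IHk.
Qed.

End DivisionRing.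

(** * Passage from ordinals to [nat], and the list of roots *)

(** It gives [d] over ['I_n] and [f], [S] over ['I_n.-1] a common index type, with default [x0] out
    of range. *)
Definition ord_extend (T : Type) (x0 : T) n (g : 'I_n -> T) (i : nat) : T :=
  oapp g x0 (insub i).

Lemma ord_extendE (T : Type) (x0 : T) n (g : 'I_n -> T) (i : 'I_n) :
  ord_extend x0 g i = g i.
Proof. by rewrite /ord_extend valK. Qed.

Lemma linear_prod_rev (D : unitRingType) n (d : 'I_n -> D) :
  linear_prod d = rev_linear_prod (ord_extend 0 d) n.
Proof. by apply: eq_bigr => i _; rewrite -(ord_extendE 0 d (rev_ord i)). Qed.

Lemma partial_prod_ord (D : unitRingType) n (S : 'I_n.-1 -> {poly D}) (k : 'I_n) :
  partial_prod S k = \prod_(i < k) ord_extend 0 S i.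
Proof.
have kn : (k <= n.-1)%N by case: n k {S} => [[]//|n k]; rewrite -ltnS.
rewrite (big_ord_widen n.-1 (ord_extend 0 S)) //.
by apply: eq_bigr => i _; rewrite ord_extendE.
Qed.

Theorem theorem9 (D : unitRingType) (divD : division_ring D)
    (n : nat) (d : 'I_n -> D)
    (d_alg : forall i : 'I_n.-1,
       algebraic_over_center (d (widen_ord (leq_pred n) i)))
    (f : 'I_n.-1 -> {poly D})
    (f_min : forall i : 'I_n.-1,
       is_minpoly_over_center (d (widen_ord (leq_pred n) i)) (f i))
    (S : 'I_n.-1 -> {poly D})
    (fS : forall i : 'I_n.-1,
       f i = S i * ('X - (d (widen_ord (leq_pred n) i))%:P))
    (d_conj : forall i j : 'I_n,
       i != j -> conj_class (d i) <> conj_class (d j)) :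
  [/\ forall k : 'I_n, (partial_prod S k).[d k] != 0,
      injective (zeta d S)
    & [set z : D | root (linear_prod d) z] = range (zeta d S)].
Proof.
pose e := ord_extend 0 d.
pose fe := ord_extend 0 f; pose Se := ord_extend 0 S.
(* Below k < n the families [fe] and [Se] take their true values, never the default 0. *)
have kn (k : 'I_n) i : (i < k)%N -> (i < n.-1)%N.
  by move=> ik; rewrite -subn1 ltn_subRL add1n (leq_trans _ (ltn_ord k)).
have ed i (i_n : (i < n)%N) : e i = d (Ordinal i_n).
  exact: (ord_extendE 0 d (Ordinal i_n)).
have edw (i : 'I_n.-1) : e i = d (widen_ord (leq_pred n) i).
  exact: (ord_extendE 0 d (widen_ord _ i)).
have fmin (k : 'I_n) i : (i < k)%N -> is_minpoly_over_center (e i) (fe i).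
  move=> /kn i_n; rewrite (edw (Ordinal i_n)) /fe (ord_extendE 0 f (Ordinal i_n)).
  exact: f_min.
have fZ (k : 'I_n) i : (i < k)%N -> center_poly (fe i) by move=> /fmin[].
have fSe (k : 'I_n) i : (i < k)%N -> fe i = Se i * ('X - (e i)%:P).
  move=> /kn i_n; rewrite (edw (Ordinal i_n)) /fe /Se.
  by rewrite (ord_extendE 0 f (Ordinal i_n)) (ord_extendE 0 S (Ordinal i_n)) fS.
have einj i j : (i < n)%N -> (j < n)%N ->
    conj_class (e i) = conj_class (e j) -> i = j.
  move=> i_n j_n; rewrite !ed => ij; apply/eqP; apply: contraPT ij => ij.
  exact: d_conj.
have P0 (k : 'I_n) : (partial_prod S k).[d k] != 0.
  rewrite partial_prod_ord -(ord_extendE 0 d).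
  apply: (cofactor_prod_neq0 divD (fmin k) (fSe k)) => i ik.
  move=> /(einj _ _ (ltn_trans ik (ltn_ord k)) (ltn_ord k)) i_eq_k.
  by rewrite i_eq_k ltnn in ik.
have zetaP (k : 'I_n) :
    zeta d S k * (partial_prod S k).[d k] = (partial_prod S k).[d k] * d k.
  by rewrite mulrVK // divD.
have zeta_conj k : conj_class (d k) (zeta d S k).
  exact: (conj_classP divD (P0 k) (zetaP k)).
have zeta_root k : root (linear_prod d) (zeta d S k).
  (* As k counts from 0, [d k] is in the leftmost of the first [k.+1] factors. *)
  rewrite linear_prod_rev; apply: (@root_rev_linear_prod_leq _ _ k.+1) => //.
  have := zetaP k; have := P0 k.
  rewrite partial_prod_ord -(ord_extendE 0 d).
  exact: (root_rev_linear_prod_cofactor divD (fZ k) (fSe k)).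
split=> // [k l kl|].
  have [//|/d_conj[]] := eqVneq k l.
  by rewrite (conj_class_eq divD (zeta_conj k)) kl -(conj_class_eq divD (zeta_conj l)).
apply/seteqP; split=> [z rz|_ [k _ <-]]; last exact: zeta_root.
(* z is conjugate to some [d i], hence to the root [zeta d S i], and a class contains at most one
   root. *)
have := rz; rewrite /= linear_prod_rev => /(root_rev_linear_prod_conj divD)[i i_n].
rewrite -/e ed => iz; exists (Ordinal i_n) => //.
apply: (root_rev_linear_prod_unique divD einj).
- by rewrite -linear_prod_rev.
- by rewrite -linear_prod_rev.
- exact: (conj_class_sub divD (conj_class_sym divD (zeta_conj _)) iz).
Qed.
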